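(* Let $Y\in\mathbb{R}^{n\times p}$ and $\mathcal M=\{u\in\mathbb{R}^n:\|u\|=1\}$. Suppose that the optimal value of the problem $\min\{\|Y^Tx\|_1:x\in\mathcal M\}$ is not $0$, and let $\widehat F(x)=\|Y^Tx\|_1+\delta_{\mathcal M}(x)$. Then $\widehat F$ is a KL function with exponent $1/2$.
   Context: $\|\cdot\|$ is the Euclidean norm, $\|\cdot\|_1$ the $\ell_1$ norm, $\delta_{\mathcal M}$ the indicator function of $\mathcal M$ ($0$ on $\mathcal M$, $+\infty$ elsewhere). Subdifferentials. For a proper closed $h:\mathbb{R}^n\to(-\infty,\infty]$ and $\bar x\in\mathrm{dom}\,h$, the regular subdifferential is $\widehat\partial h(\bar x)=\{v:\liminf_{x\to\bar x,x\ne\bar x}\frac{h(x)-h(\bar x)-\langle v,x-\bar x\rangle}{\|x-\bar x\|}\ge0\}$ and the limiting subdifferential is $\partial h(\bar x)=\{v:\exists x^k\to\bar x,\ h(x^k)\to h(\bar x),\ v^k\in\widehat\partial h(x^k),\ v^k\to v\}$; both are empty outside $\mathrm{dom}\,h$; $\mathrm{dom}\,\partial h=\{x:\partial h(x)\ne\emptyset\}$. KL exponent. A proper closed $h$ satisfies the KL property at $\hat x\in\mathrm{dom}\,\partial h$ with exponent $\alpha\in[0,1)$ if there are $a\in(0,\infty]$, $a_0>0$ and a neighborhood $V$ of $\hat x$ such that, with $\varphi(\nu)=a_0\nu^{1-\alpha}$, one has $\varphi'(h(x)-h(\hat x))\,\mathrm{dist}(0,\partial h(x))\ge1$ for all $x\in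 V$ with $h(\hat x)<h(x)<h(\hat x)+a$ (where the distance to the empty set is $+\infty$). $h$ is a KL function with exponent $\alpha$ if this holds at every $\hat x\in\mathrm{dom}\,\partial h$. *)

(* Defs.v *)
From mathcomp Require Export all_boot all_order all_algebra.
From mathcomp Require Export all_classical all_reals all_analysis.
Export Order.TTheory GRing.Theory Num.Theory.
Export numFieldNormedType.Exports.

Set Implicit Arguments.
Unset Strict Implicit.
Unset Printing Implicit Defensive.

Local Open Scope classical_set_scope.
Local Open Scope ring_scope.
Local Open Scope ereal_scope.

Section Norms.
Context {R : realType} {n : nat}.
Implicit Types (x v : 'cV[R]_n).

Definition inner v x : R := (\sum_i v i ord0 * x i ord0)%R.

(* The library norm on matrices is the sup norm, hence these two. The topology
   used on 'cV[R]_n below is the library one, which is the Euclidean one. *)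
Definition l2norm x : R := Num.sqrt (\sum_i x i ord0 ^+ 2)%R.

Definition l1norm x : R := (\sum_i `|x i ord0|)%R.

Definition unit_sphere : set 'cV[R]_n := [set x | l2norm x = 1%R].

Definition indicator_fun (M : set 'cV[R]_n) x : \bar R := if x \in M then 0 else +oo.

End Norms.

Section Subdifferentials.
Context {R : realType} {n : nat}.
Implicit Types (h : 'cV[R]_n -> \bar R) (x : 'cV[R]_n).

Definition edom h : set 'cV[R]_n := [set x | h x < +oo].

Definition proper_fun h : Prop := (forall x, -oo < h x) /\ edom h !=set0.

Definition proper_closed h : Prop := proper_fun h /\ lower_semicontinuous h.

Definition regular_subdiff h x : set 'cV[R]_n :=
  [set v | edom h x /\
    0 <= limf_einf
      (fun y => (h y - h x - (inner v (y - x)%R)%:E) * ((l2norm (y - x))^-1)%:E)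
      x^'].

Definition limiting_subdiff h x : set 'cV[R]_n :=
  [set v | edom h x /\
    exists (xk vk : nat -> 'cV[R]_n),
      [/\ xk k @[k --> \oo] --> x,
          h (xk k) @[k --> \oo] --> h x,
          forall k, regular_subdiff h (xk k) (vk k) &
          vk k @[k --> \oo] --> v]].

Definition dom_subdiff h : set 'cV[R]_n :=
  [set x | limiting_subdiff h x !=set0].

(* +oo when S is empty *)
Definition dist0 (S : set 'cV[R]_n) : \bar R :=
  ereal_inf [set (l2norm v)%:E | v in S].

End Subdifferentials.

Section KL.
Context {R : realType} {n : nat}.
Implicit Types (h : 'cV[R]_n -> \bar R) (alpha : R).

(* Under the bounds on h x, the argument of the derivative is the positive real
   number h x - h xhat. *)
Definition KL_at h alpha (xhat : 'cV[R]_n) : Prop :=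
  exists (a : \bar R) (a0 : R) (V : set 'cV[R]_n),
    [/\ 0 < a, (0 < a0)%R, nbhs xhat V &
      let phi (nu : R) : R := (a0 * nu `^ (1 - alpha))%R in
      forall x, V x -> h xhat < h x -> h x < h xhat + a ->
        1 <= (derive1 phi (fine (h x - h xhat)))%:E * dist0 (limiting_subdiff h x)].

Definition KL_function h alpha : Prop :=
  [/\ proper_closed h, (0 <= alpha < 1)%R &
      forall xhat, dom_subdiff h xhat -> KL_at h alpha xhat].

End KL.

Definition Fhat {R : realType} {n p : nat} (Y : 'M[R]_(n, p)) (x : 'cV[R]_n) :
    \bar R :=
  (l1norm (Y^T *m x)%R)%:E + indicator_fun unit_sphere x.

(* Main.v *)
Require Import Defs.
From mathcomp Require Import ring lra.

(** Write f x for the l1 norm of Y^T x; it is convex, positively homogeneous,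
  and linear on each cone where the signs of the entries of Y^T x are constant.

  Let x be a unit vector and v a limiting subgradient at x of the restriction
  of f to the sphere. Normal vectors to the sphere at x are multiples of x, so
  xi = v + (f x - <v, x>) x should be a convex subgradient of f at x. Indeed
  <xi, d> <= f d for all d ([limiting_subdiff_on_sphere_le]) and <xi, x> = f x.
  If x0 has the same sign pattern as x, then f (x - e x0) = f x - e f x0 for
  small e > 0, and this forces <xi, x0> = f x0. Taking x0 on the sphere and
  projecting v orthogonally to x,
    |v| >= <v - <v, x> x, x0> = f x0 - f x * <x, x0> >= f x0 - f x
  ([limiting_subdiff_l2norm_ge]).

  The point is that x0 need not be close to x: it may be chosen once and for
  all in each sign pattern. Given z on the sphere, choose in every pattern
  which contains a unit vector of value above f z one such representative x0,
  and let c > 0 be the least of the finitely many gaps f x0 - f z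
  ([sign_pattern_gap]). When f z < f x < f z + c / 2 the estimate gives
  |v| >= c - (f x - f z) >= c / 2: just above the level f z, subgradients are
  bounded away from 0. The desingularizing function a0 * sqrt has a derivative
  bounded below near 0, so the KL inequality at z follows
  ([KL_at_half_of_slope_ge]). *)

Local Open Scope classical_set_scope.
Local Open Scope ring_scope.

(** * Euclidean geometry of column vectors *)

Section InnerProduct.
Context {R : realType} {n : nat}.
Implicit Types (x y u v : 'cV[R]_n) (a : R).

Lemma innerC u v : inner u v = inner v u.
Proof. by apply: eq_bigr => i _; rewrite mulrC. Qed.

Lemma innerDl u v x : inner (u + v) x = inner u x + inner v x.
Proof. by rewrite -big_split; apply: eq_bigr => i _; rewrite mxE mulrDl. Qed.

Lemma innerZl a u x : inner (a *: u) x = a * inner u x.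
Proof. by rewrite mulr_sumr; apply: eq_bigr => i _; rewrite mxE mulrA. Qed.

Lemma innerDr u v x : inner x (u + v) = inner x u + inner x v.
Proof. by rewrite innerC innerDl !(innerC _ x). Qed.

Lemma innerZr a u x : inner x (a *: u) = a * inner x u.
Proof. by rewrite innerC innerZl innerC. Qed.

Lemma innerBr u v x : inner x (u - v) = inner x u - inner x v.
Proof. by rewrite -scaleN1r innerDr innerZr mulN1r. Qed.

Lemma innerBl u v x : inner (u - v) x = inner u x - inner v x.
Proof. by rewrite innerC innerBr !(innerC x). Qed.

Lemma inner_ge0 x : 0 <= inner x x.
Proof. by apply: sumr_ge0 => i _; rewrite -expr2 sqr_ge0. Qed.

Lemma l2normE x : l2norm x = Num.sqrt (inner x x).
Proof. by congr Num.sqrt; apply: eq_bigr => i _; rewrite expr2. Qed.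

Lemma l2norm_ge0 x : 0 <= l2norm x.
Proof. exact: sqrtr_ge0. Qed.

Lemma sqr_l2norm x : l2norm x ^+ 2 = inner x x.
Proof. by rewrite l2normE sqr_sqrtr// inner_ge0. Qed.

Lemma l2norm_le u v : inner u u <= inner v v -> l2norm u <= l2norm v.
Proof. by move=> uv; rewrite !l2normE ler_wsqrtr. Qed.

Lemma l2norm_eq0 x : l2norm x = 0 -> x = 0.
Proof.
move=> /(congr1 (fun r => r ^+ 2)); rewrite sqr_l2norm expr0n/= => /eqP.
rewrite psumr_eq0 => [/allP x0|i _]; last by rewrite -expr2 sqr_ge0.
apply/matrixP => i j; rewrite ord1 mxE; apply/eqP.
by have := x0 i (mem_index_enum i); rewrite mulf_eq0 orbb.
Qed.

Lemma inner_unit x : l2norm x = 1 -> inner x x = 1.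
Proof. by move=> x1; rewrite -sqr_l2norm x1 expr1n. Qed.

Lemma l2normZ a x : 0 <= a -> l2norm (a *: x) = a * l2norm x.
Proof.
move=> a0; rewrite !l2normE innerZl innerZr mulrA -expr2.
by rewrite sqrtrM ?sqr_ge0// sqrtr_sqr ger0_norm.
Qed.

(** Pythagoras for the component of [v] orthogonal to the unit vector [u]; the
  two estimates that follow are read off it. *)
Lemma inner_orthog u v : l2norm u = 1 ->
  inner (v - inner v u *: u) (v - inner v u *: u) = inner v v - inner v u ^+ 2.
Proof.
move=> /inner_unit u1.
rewrite innerBl !innerBr !innerZl !innerZr u1 (innerC u v); ring.
Qed.

Lemma l2norm_orthog_le u v : l2norm u = 1 ->
  l2norm (v - inner v u *: u) <= l2norm v.
Proof.
by move=> u1; rewrite l2norm_le// inner_orthog// gerBl sqr_ge0.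
Qed.

Lemma inner_le_l2norm u v : l2norm u = 1 -> inner v u <= l2norm v.
Proof.
move=> u1; have := inner_ge0 (v - inner v u *: u).
rewrite inner_orthog// subr_ge0 -sqr_l2norm => h.
rewrite (le_trans (ler_norm _))// -(ler_pXn2r (n := 2)) ?nnegrE ?l2norm_ge0//.
by rewrite real_normK// num_real.
Qed.

Lemma cvg_inner {T : Type} {F : set_system T} {FF : Filter F}
    (u x : T -> 'cV[R]_n) (u0 x0 : 'cV[R]_n) :
  u t @[t --> F] --> u0 -> x t @[t --> F] --> x0 ->
  inner (u t) (x t) @[t --> F] --> inner u0 x0.
Proof.
move=> cu cx; apply: cvg_big => [|i _]; first exact: add_continuous.
have coord (w : T -> 'cV[R]_n) (w0 : 'cV[R]_n) : w t @[t --> F] --> w0 ->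
    w t i ord0 @[t --> F] --> w0 i ord0.
  move=> cw; apply: (@cvg_comp _ _ _ w (fun M => M i ord0) _ _ _ cw).
  exact: coord_continuous.
by apply: cvgM; exact: coord.
Qed.

Lemma cvg_l2norm {T : Type} {F : set_system T} {FF : Filter F}
    (x : T -> 'cV[R]_n) (x0 : 'cV[R]_n) :
  x t @[t --> F] --> x0 -> l2norm (x t) @[t --> F] --> l2norm x0.
Proof.
move=> cx; have -> : @l2norm R n = fun y => Num.sqrt (inner y y).
  by apply/funext => y; rewrite l2normE.
have /= := cvg_comp _ _ (cvg_inner _ _ _ _ cx cx) (@sqrt_continuous R _).
exact.
Qed.

Lemma continuous_inner u : continuous (inner u).
Proof.
move=> x.
exact: (cvg_inner (F := nbhs x) (fun=> u) id u x (cvg_cst u) cvg_id).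
Qed.

Lemma continuous_l2norm : continuous (@l2norm R n).
Proof. by move=> x; exact: (cvg_l2norm (F := nbhs x) id x cvg_id). Qed.

End InnerProduct.

(** * Sublinear functions restricted to the unit sphere *)

Section Sublinear.
Context {R : realType} {n : nat}.
Implicit Types (f : 'cV[R]_n -> R) (x v d : 'cV[R]_n).

Definition sublinear f : Prop :=
  (forall x y, f (x + y) <= f x + f y) /\
  (forall a x, 0 <= a -> f (a *: x) = a * f x).

(** The sum of [f] and of the indicator function of the unit sphere; [Fhat Y]
  is the case where [f x] is the l1 norm of [Y^T x]. *)
Definition on_sphere f x : \bar R := ((f x)%:E + indicator_fun unit_sphere x)%E.

Lemma on_sphereE f x : l2norm x = 1 -> on_sphere f x = (f x)%:E.
Proof.
by move=> x1; rewrite /on_sphere /indicator_fun mem_set// adde0.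
Qed.

Lemma on_sphereNE f x : l2norm x <> 1 -> on_sphere f x = +oo%E.
Proof.
by move=> x1; rewrite /on_sphere /indicator_fun memNset.
Qed.

Lemma edom_on_sphere f x : edom (on_sphere f) x -> l2norm x = 1.
Proof. by apply: contraPP => x1; rewrite /edom/= on_sphereNE. Qed.

(** The lower limit in the definition of regular subgradients only matters
  along the sphere, where the function is finite; there it becomes a first-order
  lower estimate with error [e * l2norm (y - x)]. *)
Lemma regular_subdiff_on_sphere f x v (e : R) : 0 < e ->
  regular_subdiff (on_sphere f) x v ->
  \forall y \near x, l2norm y = 1 ->
    - e * l2norm (y - x) <= f y - f x - inner v (y - x).
Proof.
move=> e0 [/edom_on_sphere x1]; rewrite limf_einfE => h.
have /ereal_sup_gt[_ [A Ax <-] eA] : ((- e)%:E <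
    ereal_sup [set ereal_inf
    [set (on_sphere f y - on_sphere f x - (inner v (y - x))%:E) *
    ((l2norm (y - x))^-1)%:E | y in V] | V in x^'])%E.
  by apply: lt_le_trans h; rewrite lte_fin oppr_lt0.
rewrite /dnbhs /within/= in Ax; near=> y => y1.
have [->|yx] := eqVneq y x.
  by rewrite !subrr -(scale0r x) l2normZ// innerZr !mul0r mulr0 subrr.
have Ay : A y by apply: (near Ax y).
have : ((- e)%:E <= (on_sphere f y - on_sphere f x - (inner v (y - x))%:E) *
    ((l2norm (y - x))^-1)%:E)%E.
  by apply/ltW/(lt_le_trans eA)/ereal_inf_lbound; exists y.
rewrite !on_sphereE// -!EFinB -EFinM lee_fin.
rewrite ler_pdivlMr// lt_neqAle eq_sym l2norm_ge0 andbT.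
by apply: contra_neq yx => /l2norm_eq0/subr0_eq.
Unshelve. all: by end_near. Qed.

(** The norm of [x + t *: d] is [1 + t * inner d x] up to second order. The
  lower bound is Cauchy-Schwarz against [x]; the upper bound is
  [2 * N <= N ^+ 2 + 1] for the norm [N]. *)
Lemma l2norm_shift_bounds x d (t : R) : l2norm x = 1 ->
  1 + t * inner d x <= l2norm (x + t *: d)
    <= 1 + t * inner d x + t ^+ 2 * inner d d / 2.
Proof.
move=> x1; apply/andP; split.
  rewrite -{1}(inner_unit _ x1) -innerZl -innerDl.
  exact: inner_le_l2norm.
have := sqr_ge0 (l2norm (x + t *: d) - 1).
have := sqr_l2norm (x + t *: d).
rewrite innerDl !innerDr !innerZl !innerZr (inner_unit _ x1) (innerC x d).
by set N := l2norm _; nra.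
Qed.

(** Normalizing [x + t *: d] moves the unit vector [x] by [O(t)]. The bound
  comes from expanding the squared distance between two unit vectors as
  [2 - 2 <x, y>]. *)
Lemma l2norm_retract_le x d (t : R) (N := l2norm (x + t *: d)) :
  l2norm x = 1 -> 0 <= t -> 2^-1 <= N ->
  l2norm (N^-1 *: (x + t *: d) - x) <= 2 * t * l2norm d.
Proof.
move=> x1 t0 N2; have N0 : 0 < N by apply: lt_le_trans N2; rewrite invr_gt0.
rewrite -(ler_pXn2r (n := 2)) ?nnegrE ?mulr_ge0 ?l2norm_ge0//.
rewrite !exprMn !sqr_l2norm innerBl !innerBr !innerZl !innerZr.
rewrite -[inner (x + t *: d) (x + t *: d)]sqr_l2norm -/N.
rewrite innerDl innerDr innerZl innerZr (inner_unit _ x1) (innerC x d).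
have /andP[] := l2norm_shift_bounds _ d t x1; rewrite -/N => N_ge N_le.
have Ni0 : 0 <= N^-1 by rewrite invr_ge0 ltW.
have Ni2 : N^-1 <= 2 by rewrite -[leRHS]invrK lef_pV2 ?posrE ?invr_gt0.
have -> : N^-1 * (N^-1 * N ^+ 2) = 1 by field; rewrite gt_eqF.
have D0 := inner_ge0 d.
have NN : N^-1 * N = 1 by rewrite mulVf ?gt_eqF.
have h1 : N^-1 * (N - (1 + t * inner d x)) <= N^-1 * (t ^+ 2 * inner d d / 2).
  by rewrite ler_wpM2l//; lra.
have h2 : N^-1 * (t ^+ 2 * inner d d / 2) <= 2 * (t ^+ 2 * inner d d / 2).
  by rewrite ler_wpM2r// divr_ge0// mulr_ge0// sqr_ge0.
rewrite mulrBr NN in h1; have t2 := sqr_ge0 t.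
have := mulr_ge0 t2 D0; lra.
Qed.

Lemma cvg_retract x d : l2norm x = 1 ->
  (l2norm (x + t *: d))^-1 *: (x + t *: d) @[t --> (0 : R)^'+] --> x.
Proof.
move=> x1.
have cx : x + t *: d @[t --> (0 : R)^'+] --> x.
  have t0 : t @[t --> (0 : R)^'+] --> (0 : R).
    by apply: cvg_at_right_filter; exact: cvg_id.
  have := cvgD (cvg_cst x) (cvgZ t0 (cvg_cst d)).
  by rewrite scale0r addr0; apply.
have := cvgZ (cvgV _ (cvg_l2norm _ _ cx)) cx.
by rewrite x1 invr1 scale1r; apply; exact: oner_neq0.
Qed.

(** The regular subgradient inequality is tested along the normalized ray
  [N^-1 *: (x + t *: d)], with [N] the norm of [x + t *: d]. By sublinearity
  [N * f] is at most [f x + t * f d] there, so after multiplication by [N] and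
  since [N - 1] is [t * inner d x] up to [O(t^2)], the terms of order [t] give
  the claim. *)
Lemma regular_subdiff_on_sphere_le f x v d : sublinear f ->
  regular_subdiff (on_sphere f) x v ->
  inner (v + (f x - inner v x) *: x) d <= f d.
Proof.
move=> [fD fZ] vx; have x1 : l2norm x = 1 by case: vx => /edom_on_sphere.
set K := f x - inner v x; apply/ler_addgt0Pr => eta eta0.
have nd0 := l2norm_ge0 d; have D0 := inner_ge0 d.
(* [N * e * l2norm (y - x)] is bounded by [4 * t * e * l2norm d] below, and
   this choice of [e] brings it under [t * eta / 2]. *)
pose e := eta / (8 * (l2norm d + 1)).
have e0 : 0 < e by rewrite divr_gt0// mulr_gt0// ltr_wpDl.
have /= near_ge : \forall t \near (0 : R)^'+, _ :=
  cvg_retract x d x1 _ (regular_subdiff_on_sphere _ _ _ _ e0 vx).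
(* [t <= del] absorbs the second-order term [`|K| * t ^+ 2 * inner d d / 2]. *)
pose del := eta / (`|K| * inner d d + 1).
have KD0 : 0 <= `|K| * inner d d by rewrite mulr_ge0.
have del0 : 0 < del by rewrite divr_gt0// ltr_wpDl.
(* [t <= g] keeps [N] between 1/2 and 2. *)
pose g := (2 * (`|inner d x| + inner d d + 1))^-1.
have g0 : 0 < g by rewrite invr_gt0 mulr_gt0// ltr_wpDl// addr_ge0.
near ((0 : R)^'+) => t.
have t0 : 0 < t by near: t; exact: nbhs_right_gt.
have tdel : t <= del by near: t; exact: nbhs_right_ltW.
have tg : t <= g by near: t; exact: nbhs_right_ltW.
have t1 : t <= 1 by near: t; exact: nbhs_right_ltW.
have := near near_ge t; rewrite /=.
set N := l2norm (x + t *: d).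
have /andP[] := l2norm_shift_bounds _ d t x1; rewrite -/N => N_ge N_le.
have tgs : t * (`|inner d x| + inner d d + 1) <= 2^-1.
  move: tg; rewrite /g invfM ler_pdivlMr//.
  by rewrite ltr_wpDl// addr_ge0.
have tc : `|t * inner d x| <= t * `|inner d x| by rewrite normrM gtr0_norm.
have tc' := ler_norm (- (t * inner d x)); rewrite normrN in tc'.
have tc'' := ler_norm (t * inner d x).
have tD : t ^+ 2 * inner d d <= t * inner d d.
  by rewrite ler_wpM2r// expr2 ger_pMr.
have N2 : 2^-1 <= N by have := mulr_ge0 (ltW t0) D0; lra.
have N2' : N <= 2 by have := mulr_ge0 (ltW t0) D0; lra.
have N0 : 0 < N by apply: lt_le_trans N2; rewrite invr_gt0.
have := l2norm_retract_le x d t x1 (ltW t0) N2; rewrite -/N.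
set y := N^-1 *: (x + t *: d) => yx yt.
have Ny : N *: y = x + t *: d by rewrite scalerA mulfV ?gt_eqF// scale1r.
have y1 : l2norm y = 1.
  by rewrite l2normZ ?invr_ge0 ?ltW// mulVf// gt_eqF.
have {}yt : - e * l2norm (y - x) <= f y - f x - inner v (y - x).
  exact: yt.
have fy : N * f y <= f x + t * f d.
  by rewrite -(fZ _ _ (ltW N0)) Ny -(fZ _ _ (ltW t0)).
have vy : N * inner v y = inner v x + t * inner v d.
  by rewrite -innerZr Ny innerDr innerZr.
have {}yt : - (t * eta / 2) <= t * (f d - inner v d) - (N - 1) * K.
  have e1 : e * (8 * (l2norm d + 1)) = eta.
    by rewrite /e mulfVK// gt_eqF// mulr_gt0// ltr_wpDl.
  have e2 : N * (e * l2norm (y - x)) <= t * eta / 2.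
    apply: (@le_trans _ _ (2 * (e * (2 * t * l2norm d)))).
      apply: ler_pM => //; [exact: ltW| |by rewrite ler_pM2l].
      by rewrite mulr_ge0 ?l2norm_ge0// ltW.
    by have := mulr_gt0 t0 e0; nra.
  have := ler_wpM2l (ltW N0) yt; rewrite innerBr /K; nra.
have NK : (N - 1 - t * inner d x) * K >= - (t * eta / 2).
  have : t * (`|K| * inner d d + 1) <= eta.
    by move: tdel; rewrite /del ler_pdivlMr// ltr_wpDl.
  move=> /(ler_wpM2l (ltW t0)); have := ler_norm (- K); rewrite normrN.
  have : 0 <= N - 1 - t * inner d x by lra.
  have : N - 1 - t * inner d x <= t ^+ 2 * inner d d / 2 by lra.
  have := normr_ge0 K.
  set P := N - 1 - _ => K0 P1 P0 KK.
  have : P * `|K| <= t ^+ 2 * inner d d / 2 * `|K| by rewrite ler_wpM2r.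
  have : P * (- K) <= P * `|K| by rewrite ler_wpM2l.
  have := sqr_ge0 t; lra.
rewrite -(ler_pM2l t0) innerDl innerZl (innerC x d); nra.
Unshelve. all: by end_near. Qed.

(** Both sides are continuous in the pair [(x, v)], so the inequality for
  regular subgradients passes to the limit. *)
Lemma limiting_subdiff_on_sphere_le f x v d :
  sublinear f -> continuous f -> limiting_subdiff (on_sphere f) x v ->
  inner (v + (f x - inner v x) *: x) d <= f d.
Proof.
move=> fsub fcont [_ [xk [vk [cx _ rv cv]]]].
have cf : f (xk k) @[k --> \oo] --> f x.
  by apply: (cvg_comp _ _ cx); exact: fcont.
apply: (@cvgr_to_le _ \oo _ _
  (fun k => inner (vk k + (f (xk k) - inner (vk k) (xk k)) *: xk k) d)).
  apply: cvg_inner; last exact: cvg_cst.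
  apply: cvgD => //; apply: cvgZ => //.
  by apply: cvgB => //; exact: cvg_inner.
by near=> k; exact: regular_subdiff_on_sphere_le.
Unshelve. all: by end_near. Qed.

(** Moving from [x] against [x0] reverses the subgradient inequality: if [f]
  decreases at the rate [f x0], then [inner xi] cannot decrease more slowly. *)
Lemma subgradient_tangent f xi x x0 (e : R) : 0 < e ->
  (forall d, inner xi d <= f d) -> inner xi x = f x ->
  f (x - e *: x0) = f x - e * f x0 -> f x0 <= inner xi x0.
Proof.
move=> e0 xif xix fe; have := xif (x - e *: x0).
by rewrite fe innerBr xix innerZr lerD2l lerN2 ler_pM2l.
Qed.

(** The component of [v] orthogonal to [x] has inner product at least
  [f x0 - f x * inner x x0] with [x0], whatever the distance from [x] to
  [x0]. *)
Lemma limiting_subdiff_l2norm_ge f x x0 v (e : R) :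
  sublinear f -> continuous f -> limiting_subdiff (on_sphere f) x v ->
  l2norm x0 = 1 -> 0 <= f x -> 0 < e -> f (x - e *: x0) = f x - e * f x0 ->
  f x0 - f x <= l2norm v.
Proof.
move=> fsub fcont vx x01 fx0 e0 fe.
have x1 : l2norm x = 1 by case: vx => /edom_on_sphere.
have xif d := limiting_subdiff_on_sphere_le f x v d fsub fcont vx.
have xix : inner (v + (f x - inner v x) *: x) x = f x.
  by rewrite innerDl innerZl (inner_unit _ x1); ring.
have := subgradient_tangent _ _ _ _ _ e0 xif xix fe.
rewrite innerDl innerZl => h.
have xx0 : inner x x0 <= 1 by rewrite -x1 inner_le_l2norm.
have := inner_le_l2norm x0 (v - inner v x *: x) x01.
rewrite innerBl innerZl => h2; have := l2norm_orthog_le x v x1.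
have := ler_wpM2l fx0 xx0; lra.
Qed.

Lemma proper_on_sphere f : (0 < n)%N -> proper_fun (on_sphere f).
Proof.
move=> n0; split=> [x|].
  have [x1|x1] := pselect (l2norm x = 1).
    by rewrite on_sphereE// ltNyr.
  by rewrite on_sphereNE.
pose i0 := Ordinal n0.
exists (delta_mx i0 ord0); rewrite /edom/= on_sphereE ?ltry//.
rewrite /l2norm (bigD1 i0)//= big1 => [|i /negPf ii0].
  by rewrite mxE !eqxx expr1n addr0 sqrtr1.
by rewrite mxE ii0 expr0n.
Qed.

Lemma lower_semicontinuous_on_sphere f :
  continuous f -> lower_semicontinuous (on_sphere f).
Proof.
move=> fcont x a; have [x1|x1] := pselect (l2norm x = 1).
  rewrite on_sphereE// lte_fin => ax.
  exists [set y | a < f y]; first exact: (cvgr_gt _ (fcont x) _ ax).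
  move=> y /= ay; have [y1|y1] := pselect (l2norm y = 1).
    by rewrite on_sphereE.
  by rewrite on_sphereNE// ltry.
move=> _; exists [set y | l2norm y != 1].
  have /(_ [set r | r != 1]) := continuous_l2norm x; apply.
  by apply: open_nbhs_nbhs; split; [exact: open_neq|exact/eqP].
by move=> y /= /eqP y1; rewrite on_sphereNE// ltry.
Qed.

End Sublinear.

(** * The KL inequality from a lower bound on subgradients *)

Section KL.
Context {R : realType}.

Lemma derive1_half_power (a0 nu : R) : 0 < nu ->
  derive1 (fun t : R => a0 * t `^ (1 - 2^-1)) nu = a0 / 2 / Num.sqrt nu.
Proof.
have -> : 1 - 2^-1 = 2^-1 :> R by field.
move=> nu0; rewrite derive1E.
have D := is_deriveZ a0 (is_derive1_powR 2^-1 nu0).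
rewrite (@derive_val _ _ _ _ _ _ _ D) /GRing.scale/= mulrA.
have -> : 2^-1 - 1 = - 2^-1 :> R by field.
by rewrite powRN powR12_sqrt// ltW.
Qed.

(** If the subgradients just above the level of [z] are at least [c] in norm,
  the neighborhood can be the whole space: with [m = min(c, 1)] and
  [a0 = 2 / m], the derivative [a0 / (2 sqrt nu)] is at least [1 / m] for
  [nu < m <= 1]. *)
Lemma KL_at_half_of_slope_ge n (h : 'cV[R]_n -> \bar R) (z : 'cV[R]_n)
    (r c : R) :
  0 < c -> h z = r%:E ->
  (forall x (s : R), h x = s%:E -> r < s < r + c -> forall v,
    limiting_subdiff h x v -> c <= l2norm v) ->
  KL_at h 2^-1 z.
Proof.
move=> c0 hz hge; pose m := Num.min c 1.
have m0 : 0 < m by rewrite lt_min c0 ltr01.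
have mc : m <= c by rewrite ge_min lexx.
have m1 : m <= 1 by rewrite ge_min lexx orbT.
exists m%:E, (2 / m), setT; split; [by []|by rewrite divr_gt0|exact: filterT|].
rewrite /= hz => x _; case hx : (h x) => [s| |] //=.
rewrite -EFinD !lte_fin => rs sm.
rewrite derive1_half_power ?subr_gt0//.
set D := _ / Num.sqrt _.
have sq0 : 0 < Num.sqrt (s - r) by rewrite sqrtr_gt0 subr_gt0.
have D1 : 1 <= D * m.
  have -> : D * m = (Num.sqrt (s - r))^-1.
    by rewrite /D; field; rewrite !gt_eqF.
  rewrite invf_ge1// -[leRHS]sqrtr1 ler_wsqrtr//; lra.
have D0 : 0 <= D by rewrite !mulr_ge0 ?invr_ge0// ltW.
apply: (@le_trans _ _ (D%:E * m%:E)%E); first by rewrite -EFinM lee_fin.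
apply: lee_wpmul2l; first by rewrite lee_fin.
apply: le_ereal_inf_tmp => _ [v vx <-]; rewrite lee_fin (le_trans mc)//.
apply: hge vx; first exact: hx.
by rewrite rs (lt_le_trans sm)// lerD2l.
Qed.

End KL.

(** * Sign patterns of the l1 norm of a linear map *)

Section L1.
Context {R : realType} {n p : nat} (Y : 'M[R]_(n, p)).
Implicit Types (x : 'cV[R]_n).

Definition l1Y x := l1norm (Y^T *m x).

Lemma l1Y_ge0 x : 0 <= l1Y x.
Proof. exact: sumr_ge0. Qed.

Lemma sublinear_l1Y : sublinear l1Y.
Proof.
split=> [x y|a x a0]; rewrite /l1Y /l1norm.
  by rewrite -big_split ler_sum// => i _; rewrite mulmxDr mxE ler_normD.
rewrite mulr_sumr; apply: eq_bigr => i _.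
by rewrite -scalemxAr mxE normrM ger0_norm.
Qed.

Lemma continuous_l1Y : continuous l1Y.
Proof.
have -> : l1Y = fun x => \sum_i `|inner (col i Y) x|.
  apply/funext => x; apply: eq_bigr => i _; rewrite mxE.
  by congr `|_|; apply: eq_bigr => j _; rewrite !mxE.
apply: continuous_big => [|i _ x]; first exact: add_continuous.
exact: (continuous_comp (continuous_inner _ x) (@norm_continuous _ _ _)).
Qed.

(** The sign vector of [Y^T x], coded as pairs of booleans in order to have
  values in a finite type. *)
Definition sign_pattern x : {ffun 'I_p -> bool * bool} :=
  [ffun i => let a := (Y^T *m x) i ord0 in (0 < a, a < 0)].

(** For small [e] no entry of [Y^T x] changes sign when [e *: x0] is subtracted
  from [x], because an entry vanishes at [x] only if it does at [x0]. *)
Lemma sign_pattern_tangent x x0 : sign_pattern x = sign_pattern x0 ->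
  exists2 e : R, 0 < e & l1Y (x - e *: x0) = l1Y x - e * l1Y x0.
Proof.
move=> /ffunP s.
have near_le : \forall e \near (0 : R)^'+, forall i,
   e * `|(Y^T *m x0) i ord0| <= `|(Y^T *m x) i ord0|.
  apply: filter_forall => i; have := s i; rewrite !ffunE => -[sp sn].
  have [a0|a0] := eqVneq ((Y^T *m x) i ord0) 0.
    have -> : (Y^T *m x0) i ord0 = 0.
      by apply/eqP; rewrite eq_le !leNgt -sp -sn a0 ltxx.
    by apply: nearW => e; rewrite normr0 mulr0.
  have b0 : 0 < `|(Y^T *m x0) i ord0|.
    by rewrite normr_gt0 neq_lt -sp -sn -neq_lt.
  near=> e; rewrite -ler_pdivlMr//; near: e; apply: nbhs_right_ltW.
  by rewrite divr_gt0// normr_gt0.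
near (0 : R)^'+ => e.
have e0 : 0 < e by near: e; exact: nbhs_right_gt.
have e_le : forall i, e * `|(Y^T *m x0) i ord0| <= `|(Y^T *m x) i ord0|.
  by near: e.
exists e => //; rewrite /l1Y /l1norm mulr_sumr -sumrB; apply: eq_bigr => i _.
have := s i; rewrite !ffunE => -[]; have := e_le i.
have -> : (Y^T *m (x - e *: x0)) i ord0 =
    (Y^T *m x) i ord0 - e * (Y^T *m x0) i ord0.
  by rewrite mulmxBr -scalemxAr [LHS]mxE [X in _ + X]mxE [X in _ - X]mxE.
move: ((Y^T *m x) i ord0) ((Y^T *m x0) i ord0) => a b.
case: (ltrgt0P a) => a0; case: (ltrgt0P b) => b0 //= ab _ _.
- by rewrite ger0_norm// subr_ge0.
- rewrite ler0_norm; [ring|lra].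
- by rewrite a0 b0 mulr0 subrr normr0.
Unshelve. all: by end_near. Qed.

(** Finitely many patterns occur, so one gap serves for all the unit vectors
  whose value exceeds that of [z]. *)
Lemma sign_pattern_gap z : exists2 c : R, 0 < c &
  forall x, l2norm x = 1 -> l1Y z < l1Y x -> exists x0,
    [/\ l2norm x0 = 1, sign_pattern x = sign_pattern x0 & c <= l1Y x0 - l1Y z].
Proof.
have near_gap : \forall c \near (0 : R)^'+, forall s x,
    l2norm x = 1 -> sign_pattern x = s -> l1Y z < l1Y x -> exists x0,
      [/\ l2norm x0 = 1, s = sign_pattern x0 & c <= l1Y x0 - l1Y z].
  apply: filter_forall => s.
  have [[x0 [x01 x0s zx0]]|no_rep] := pselect (exists x0,
      [/\ l2norm x0 = 1, s = sign_pattern x0 & l1Y z < l1Y x0]).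
    near=> c => x _ _ _; exists x0; split=> //.
    by near: c; apply: nbhs_right_ltW; rewrite subr_gt0.
  apply: nearW => c x x1 xs zx; exfalso; apply: no_rep.
  by exists x.
near (0 : R)^'+ => c.
exists c => [|x x1 zx]; first by near: c; exact: nbhs_right_gt.
have gap : forall s x,
    l2norm x = 1 -> sign_pattern x = s -> l1Y z < l1Y x -> exists x0,
      [/\ l2norm x0 = 1, s = sign_pattern x0 & c <= l1Y x0 - l1Y z].
  by near: c.
exact: gap x1 erefl zx.
Unshelve. all: by end_near. Qed.

Lemma KL_at_on_sphere_l1Y z : l2norm z = 1 -> KL_at (on_sphere l1Y) 2^-1 z.
Proof.
move=> z1; have [c c0 gap] := sign_pattern_gap z.
apply: (@KL_at_half_of_slope_ge _ _ _ _ (l1Y z) (c / 2)).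
- exact: divr_gt0.
- exact: on_sphereE.
move=> x s xs /andP[zs sz] v vx.
have x1 : l2norm x = 1.
  by apply: (@edom_on_sphere _ _ l1Y); rewrite /edom/= xs ltry.
move: xs; rewrite on_sphereE// => -[fxs]; subst s.
have [x0 [x01 xx0 cx0]] := gap _ x1 zs.
have [e e0 fe] := sign_pattern_tangent _ _ xx0.
have := limiting_subdiff_l2norm_ge _ _ _ _ _
  sublinear_l1Y continuous_l1Y vx x01 (l1Y_ge0 _) e0 fe.
by apply: le_trans; lra.
Qed.

End L1.

Local Open Scope ereal_scope.

Theorem theorem4p3 (R : realType) (n p : nat) (n_gt0 : (0 < n)%N)
    (Y : 'M[R]_(n, p))
    (optval_neq0 :
       ereal_inf [set (l1norm (Y^T *m x)%R)%:E | x in @unit_sphere R n] <> 0) :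
  KL_function (Fhat Y) (2^-1)%R.
Proof.
have -> : Fhat Y = on_sphere (l1Y Y) by [].
split; last by move=> z [w [/edom_on_sphere z1 _]]; exact: KL_at_on_sphere_l1Y.
  split; first exact: proper_on_sphere.
  exact/lower_semicontinuous_on_sphere/continuous_l1Y.
by rewrite invr_ge0 ler0n/= invf_lt1 ?ltr1n.
Qed.
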